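(* For all integers $n\ge 0$, $$J_n(x)=\sum_{j=0}^{n}\binom{n}{j}L_{n-j}(x)\sum_{m=0}^{j}{j \brack m}.$$
   Context: All identities are between polynomials in an indeterminate $x$ with real coefficients. For $n\ge 0$, $J_n(x)=n!\sum_{k=0}^{n}\binom{n+k}{n-k}\frac{x^k}{k!}$. The polynomials $L_n(x)$ are defined by $L_n(x)=J_n(x)-nJ_{n-1}(x)$ for $n\ge 0$, where for $n=0$ the second term is read as $0$, so $L_0(x)=1$. ${n \brack k}$ denotes the unsigned Stirling numbers of the first kind, given by $\frac{1}{k!}\left(\log\frac{1}{1-t}\right)^k=\sum_{n=k}^{\infty}{n \brack k}\frac{t^n}{n!}$. *)

(* Defs.v *)
From HB Require Import structures.
From mathcomp Require Import all_boot all_order all_algebra.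
From mathcomp Require Import all_classical all_reals all_analysis.
From mathcomp Require Import zify ring lra.

Set Implicit Arguments.
Unset Strict Implicit.
Unset Printing Implicit Defensive.

Import Order.TTheory GRing.Theory Num.Theory.
Import numFieldNormedType.Exports.

Local Open Scope classical_set_scope.
Local Open Scope ring_scope.

Definition J (R : realType) (n : nat) : {poly R} :=
  n`!%:R *: \sum_(k < n.+1) ('C(n + k, n - k)%:R / k`!%:R) *: 'X^k.

Definition L (R : realType) (n : nat) : {poly R} :=
  J R n - (if n is m.+1 then n%:R *: J R m else 0).

(* The generating function identity in t, which defines the numbers [s n k]
   for k <= n, is read near 0, where a convergent power series determines its
   coefficients; [s n k] is unconstrained for n < k. *)
Definition is_stirling1 (R : realType) (s : nat -> nat -> R) : Prop :=
  forall k : nat, \forall t \near (0 : R),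
    \sum_(k <= n < N) s n k * (t ^+ n / n`!%:R) @[N --> \oo]
      --> k`!%:R^-1 * ln (1 / (1 - t)) ^+ k.

(* A solution of [is_stirling1], so that it is not a vacuous hypothesis. *)
Fixpoint stirling1_rec (n k : nat) : nat :=
  match n, k with
  | 0, 0 => 1
  | 0, _.+1 => 0
  | _.+1, 0 => 0
  | n'.+1, k'.+1 => n' * stirling1_rec n' k + stirling1_rec n' k'
  end.

Lemma stirling1_rec_le n k : (stirling1_rec n k <= n`!)%N.
Proof.
elim: n k => [|n IH] [|k] //=.
by rewrite factS mulSn addnC leq_add // leq_mul.
Qed.

Lemma stirling1_rec_small n k : (n < k)%N -> stirling1_rec n k = 0%N.
Proof.
elim: n k => [|n IH] [|k] //=; rewrite ltnS => nk.
by rewrite (IH k.+1) ?(ltnW nk)// ?muln0 ?IH // ltnS ltnW.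
Qed.

Section stirling1_egf.
Variable R : realType.
Implicit Types t x : R.

Let a (k n : nat) : R := (stirling1_rec n k)%:R / n`!%:R.
Let K : R := 4^-1.

Let a_ge0 k n : 0 <= a k n.
Proof. by rewrite divr_ge0. Qed.

Let a_le1 k n : a k n <= 1.
Proof.
by rewrite ler_pdivrMr ?ltr0n ?fact_gt0// mul1r ler_nat stirling1_rec_le.
Qed.

Let a_diffs k n : pseries_diffs (a k.+1) n = n%:R * a k.+1 n + a k n.
Proof.
rewrite /pseries_diffs /a factS [stirling1_rec n.+1 _]/= !(natrM, natrD).
field; have := fact_gt0 n; rewrite -(ltr0n R) => /lt0r_neq0 ->.
by rewrite nat1r pnatr_eq0.
Qed.

Let cvg_bound (u : nat -> R) :
  (forall n, 0 <= u n <= n.+1%:R * n.+2%:R) -> cvgn (pseries u K).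
Proof.
move=> u_bnd; apply: (@series_le_cvg _ _ (geometric 2 (3 / 4))) => //=.
- by move=> n; have /andP[? _] := u_bnd n; rewrite mulr_ge0 ?exprn_ge0 /K ?invr_ge0.
- move=> n; rewrite /geometric/= /K exprMn mulrA ler_wpM2r ?exprn_ge0 ?invr_ge0//.
  have /andP[_ /le_trans] := u_bnd n; apply.
  rewrite -natrM -natrX -natrM ler_nat.
  elim: n => [//|n IH]; rewrite expnS mulnCA.
  apply: (leq_trans _ (leq_mul (leqnn 3) IH)).
  by nia.
- by apply: is_cvg_geometric_series; rewrite ger0_norm//; lra.
Qed.

Let cvg_a k : cvgn (pseries (a k) K).
Proof.
apply: cvg_bound => n; rewrite a_ge0 (le_trans (a_le1 _ _))//.
by rewrite -natrM ler1n.
Qed.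

Let diffs_bound k n : 0 <= pseries_diffs (a k) n <= n.+1%:R.
Proof.
rewrite /pseries_diffs mulr_ge0//=.
by rewrite -[leRHS]mulr1 ler_wpM2l.
Qed.

Let cvg_diffs k : cvgn (pseries (pseries_diffs (a k)) K).
Proof.
apply: cvg_bound => n; have /andP[-> /le_trans] := diffs_bound k n; apply.
by rewrite -[leLHS]mulr1 ler_wpM2l// ler1n.
Qed.

Let cvg_diffs2 k : cvgn (pseries (pseries_diffs (pseries_diffs (a k))) K).
Proof.
apply: cvg_bound => n; have /andP[d0 d1] := diffs_bound k n.+1.
by rewrite {1 3}/pseries_diffs mulr_ge0//= ler_wpM2l.
Qed.

Let F k t : R := limn (pseries (a k) t).

Let K_norm t : `|t| < K -> `|t| < `|K|.
Proof. by rewrite [`|K|]ger0_norm// /K invr_ge0. Qed.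

Let lt1 t : `|t| < K -> 0 < 1 - t.
Proof. by rewrite ltr_norml => /andP[_]; rewrite /K; lra. Qed.

Let F_derive k t : `|t| < K -> is_derive t 1 (F k.+1) (F k t / (1 - t)).
Proof.
move=> tK; have tK' := K_norm tK.
have := pseries_snd_diffs (@cvg_a k.+1) (@cvg_diffs k.+1) (@cvg_diffs2 k.+1) tK'.
have Cd := is_cvg_pseries_inside (@cvg_diffs k.+1) tK'.
have Ca := is_cvg_pseries_inside (@cvg_a k) tK'.
set D := limn (pseries (pseries_diffs _) t).
suff -> : F k t / (1 - t) = D by [].
have D_eq : D = t * D + F k t.
  apply: cvg_lim => //.
  have -> : pseries (pseries_diffs (a k.+1)) t =
      (fun n => t * series (fun i => i%:R * a k.+1 i * t ^+ i.-1) n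
        + pseries (a k) t n).
    apply/funext => n; rewrite /pseries /series /= mulr_sumr -big_split/=.
    apply: eq_bigr => i _; rewrite a_diffs mulrDl; congr (_ + _).
    by case: i => [|i]; rewrite ?mul0r ?mulr0// exprS mulrCA.
  by apply: cvgD => //; apply: cvgMr; exact: pseries_diffs_equiv.
have /lt0r_neq0 t1 := lt1 tK.
by apply: (mulIf t1); rewrite divfK// mulrBr mulr1 {1}D_eq; ring.
Qed.

Let F0 t : F 0 t = 1.
Proof.
apply: cvg_lim => //; apply: cvg_near_cst; exists 1%N => // n /= n1.
rewrite /pseries /series /= -(prednK n1) big_nat_recl//= big1 => [|i _].
  by rewrite /a /= fact0 expr0 divr1 mulr1 addr0.
by rewrite /a /= mul0r mul0r.
Qed.

Let FS_0 k : F k.+1 0 = 0.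
Proof.
apply: cvg_lim => //; apply: cvg_near_cst; near=> n.
rewrite /pseries /series /= big1 => // -[|i] _; rewrite ?exprS ?mul0r ?mulr0//.
by rewrite /a /= !mul0r.
Unshelve. all: by end_near. Qed.

Let FE k t : `|t| < K -> F k t = k`!%:R^-1 * ln (1 / (1 - t)) ^+ k.
Proof.
elim: k t => [|k IH] t tK; first by rewrite F0 fact0 expr0 invr1 mulr1.
pose g (x : R) := k.+1`!%:R^-1 * (- ln (1 - x)) ^+ k.+1.
have lnE x : `|x| < K -> ln (1 / (1 - x)) = - ln (1 - x).
  by move=> /lt1 x1; rewrite div1r lnV.
rewrite lnE// -/(g t).
have g_derive x : `|x| < K -> is_derive x 1 g (F k x / (1 - x)).
  move=> xK; rewrite IH// lnE//.
  have ln_derive : is_derive x 1 (fun y : R => - ln (1 - y)) (1 - x)^-1.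
    have ? := is_derive1_ln (lt1 xK).
    have -> : (1 - x)^-1 = - ((1 - x)^-1 * (0 - 1)) by ring.
    exact: is_deriveN.
  have gE : g = k.+1`!%:R^-1 *: (fun y : R => - ln (1 - y)) ^+ k.+1.
    by apply/funext => y; rewrite /g !fctE.
  rewrite gE; apply: is_derive_eq.
  have := fact_gt0 k; rewrite -(ltr0n R) => /lt0r_neq0 fk.
  have /lt0r_neq0 x1 := lt1 xK.
  rewrite /GRing.scale/= factS natrM; field.
  by rewrite x1 fk nat1r pnatr_eq0.
have h_derive x : `|x| < K -> is_derive x 1 (F k.+1 - g) 0.
  move=> xK; have := F_derive k xK; have := g_derive x xK => ? ?.
  by rewrite -(subrr (F k x / (1 - x))); exact: is_deriveB.
have h0 : (F k.+1 - g) 0 = 0.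
  by rewrite !fctE FS_0 /g subr0 ln1 oppr0 expr0n mulr0 subrr.
suff : (F k.+1 - g) t = 0 by rewrite !fctE => /eqP; rewrite subr_eq0 => /eqP.
have h_cont (A : set R) : (forall x, A x -> `|x| < K) ->
    {within A, continuous (F k.+1 - g)}.
  move=> AK; apply: continuous_in_subspaceT => x /[!inE] /AK /h_derive ?.
  exact/differentiable_continuous/derivable1_diffP.
move: tK; rewrite ltr_norml => /andP[Kt tK].
have [t0|t0] := leP 0 t.
- have itvK x : 0 <= x <= t -> `|x| < K.
    by rewrite ltr_norml => /andP[? ?]; apply/andP; split; lra.
  have [x xt||c _] := @MVT_segment R (F k.+1 - g) (fun=> 0) 0 t t0.
  + by apply/h_derive/itvK; move: xt; rewrite in_itv/= => /andP[/ltW-> /ltW->].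
  + exact/h_cont.
  + by rewrite h0 mul0r subr0.
- have itvK x : t <= x <= 0 -> `|x| < K.
    by rewrite ltr_norml => /andP[? ?]; apply/andP; split; lra.
  have [x xt||c _] := @MVT_segment R (F k.+1 - g) (fun=> 0) t 0 (ltW t0).
  + by apply/h_derive/itvK; move: xt; rewrite in_itv/= => /andP[/ltW-> /ltW->].
  + exact/h_cont.
  + by rewrite h0 mul0r sub0r => /eqP; rewrite oppr_eq0 => /eqP.
Qed.

Lemma is_stirling1_rec : is_stirling1 (fun n k => (stirling1_rec n k)%:R : R).
Proof.
move=> k; exists K => [|t /=]; first by rewrite /= /K invr_gt0.
rewrite sub0r normrN => tK; rewrite -FE//.
have -> : (fun N => \sum_(k <= n < N) (stirling1_rec n k)%:R
             * (t ^+ n / n`!%:R)) = pseries (a k) t.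
  apply/funext => N; rewrite /pseries /series /=.
  have aE n : a k n * t ^+ n = (stirling1_rec n k)%:R * (t ^+ n / n`!%:R).
    by rewrite /a mulrAC -mulrA.
  under [RHS]eq_bigr do rewrite aE.
  rewrite [RHS](@big_cat_nat _ _ _ (minn k N)) ?geq_minr//=.
  rewrite [X in _ = X + _]big1_seq ?add0r => [|n]; last first.
    rewrite mem_index_iota leq_min /= => /andP[nk _].
    by rewrite stirling1_rec_small// mul0r.
  by have [kN|Nk] := leqP k N; rewrite ?(minn_idPl kN)// !big_geq// ltnW.
exact: is_cvg_pseries_inside (@cvg_a k) (K_norm tK).
Qed.

End stirling1_egf.

(* Main.v *)
Require Import Defs.
From mathcomp Require Import all_boot all_order all_algebra.
From mathcomp Require Import all_classical all_reals all_analysis.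
From mathcomp Require Import ring lra.

(** Summing the Stirling numbers of the first kind over the number of cycles
    counts all permutations, so the inner sum is [j`!] and the coefficient
    ['C(n, j) * j`!] equals [n`! / (n - j)`!].  After division by [n`!] the
    theorem therefore reads [J_n / n`! = \sum_(i <= n) L_i / i`!], and this sum
    telescopes, because [L_i / i`! = J_i / i`! - J_(i-1) / (i-1)`!] ([sum_L]).

    The numbers [s n k] are only known through the convergence of their
    generating function near 0.  The numbers given by the recurrence
    [stirling1_rec] have the same generating function, and a power series that
    vanishes on a punctured neighborhood of 0 has zero coefficients
    ([pseries_near0_eq0]); hence [s] agrees with the recurrence on [k <= n]
    ([is_stirling1_unique]), for which the sum is computed by induction
    ([sum_stirling1_rec]). *)

Import Order.TTheory GRing.Theory Num.Theory.
Import numFieldNormedType.Exports.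
Local Open Scope ring_scope.

Lemma sum_geometric_le2 (R : realType) (q : R) (N : nat) :
  0 <= q -> q <= 2^-1 -> \sum_(i < N) q ^+ i <= 2.
Proof.
move=> q0 q2; elim: N => [|N IH]; first by rewrite big_ord0.
rewrite big_ord_recl expr0; under eq_bigr do rewrite exprS.
rewrite -mulr_sumr; have : 0 <= \sum_(i < N) q ^+ i.
  by apply: sumr_ge0 => i _; exact: exprn_ge0.
nra.
Qed.

Section power_series_uniqueness.
Local Open Scope classical_set_scope.
Local Open Scope ring_scope.

(** The terms of the series at a fixed radius [r] are bounded by some [M], so at
    [t = q * r] everything beyond the constant term is dominated by
    [M * (q + q ^+ 2 + ...) <= 2 * M * q].  As the whole series is zero, so is
    its constant term, on letting [q] tend to 0.  The hypothesis leaves out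
    [t = 0], where it would give the conclusion at once, because it must
    survive the division by [t] in [pseries_near0_eq0]. *)
Lemma pseries_near0_coef0 (R : realType) (c : nat -> R) :
  (\forall t \near (0 : R)^', pseries c t N @[N --> \oo] --> (0 : R)) ->
  c 0%N = 0.
Proof.
move=> [e /= e0 ce].
have cvg_c t : 0 < t < e -> pseries c t N @[N --> \oo] --> (0 : R).
  move=> /andP[t0 te]; apply: ce; last by rewrite gt_eqF.
  by rewrite /ball_ /= sub0r normrN gtr0_norm.
pose r := e / 2.
have [r0 re] : 0 < r /\ r < e by rewrite /r; lra.
have cvgr : cvgn (pseries c r) by apply: cvgP (cvg_c r _); rewrite r0 re.
have [M M_gt0 MP] := ex_strict_bound_gt0 (cvg_series_bounded cvgr).
have cM n : `|c n| * r ^+ n <= M.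
  by have := MP n I; rewrite /= normrM (ger0_norm (exprn_ge0 _ (ltW r0))) => /ltW.
have c0_le q : 0 < q -> q <= 2^-1 -> `|c 0%N| <= 2 * M * q.
  move=> q0 q2; apply/ler_addgt0Pr => d d0.
  have tP : 0 < q * r < e by apply/andP; split; nra.
  have := cvg_c _ tP; rewrite -(cvg_shiftS (pseries c (q * r))).
  move=> /cvgr0_norm_lt/(_ d d0)[N _ /(_ N (leqnn N))] /=.
  rewrite /pseries /series /= big_mkord big_ord_recl /= expr0 mulr1.
  set T := \sum_(i < N) _ => SN.
  have TN : `|T| <= 2 * M * q.
    apply: (le_trans (ler_norm_sum _ _ _)).
    have := @sum_geometric_le2 R q N (ltW q0) q2.
    rewrite -(ler_pM2l (mulr_gt0 M_gt0 q0)) => /(le_trans _) H.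
    rewrite [leRHS](_ : _ = M * q * 2); last by ring.
    apply: H; rewrite mulr_sumr; apply: ler_sum => i _.
    rewrite normrM [`|_ ^+ _|]ger0_norm ?exprn_ge0//; last by case/andP: tP => /ltW.
    rewrite /bump /= add1n exprMn mulrCA -[leRHS]mulrA -exprS mulrC.
    by rewrite ler_wpM2r ?cM// exprn_ge0// ltW.
  have := ler_normB (c 0%N + T) T; rewrite addrK => /le_trans; apply.
  by rewrite addrC; apply: lerD => //; exact: ltW.
apply/eqP; rewrite -normr_eq0 eq_le normr_ge0 andbT leNgt; apply/negP => c0.
(* With this q the bound 2 * M * q is at most half of |c 0|. *)
pose q := Num.min 2^-1 (`|c 0%N| / (4 * M)).
have M4 : 0 < 4 * M by lra.
have q0 : 0 < q by rewrite lt_min invr_gt0 ltr0n divr_gt0.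
have q2 : q <= 2^-1 by rewrite ge_min lexx.
have : q <= `|c 0%N| / (4 * M) by rewrite ge_min lexx orbT.
rewrite ler_pdivlMr// => qc; have := c0_le q q0 q2; lra.
Qed.

(** Once the constant term is known to vanish, the series divided by [t] is the
    power series of the shifted coefficients, and it satisfies the same
    hypothesis. *)
Lemma pseries_near0_eq0 (R : realType) (c : nat -> R) :
  (\forall t \near (0 : R)^', pseries c t N @[N --> \oo] --> (0 : R)) ->
  forall n, c n = 0.
Proof.
move=> c0 n; elim: n c c0 => [|n IH] c c0; first exact: pseries_near0_coef0.
have cz := @pseries_near0_coef0 R c c0.
apply: (IH (fun i => c i.+1)); near=> t.
have t0 : t != 0 by near: t; exact: nbhs_dnbhs_neq.
have : pseries c t N @[N --> \oo] --> (0 : R) by near: t.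
rewrite -(cvg_shiftS (pseries c t)) => /(cvgMl_tmp (a := t^-1)); rewrite mulr0.
apply: cvg_trans; apply: near_eq_cvg; near=> N.
rewrite /pseries /series /= !big_mkord big_ord_recl /= cz mul0r add0r.
rewrite mulr_sumr; apply: eq_bigr => i _.
by rewrite /bump /= add1n exprS mulrCA mulKf.
Unshelve. all: by end_near. Qed.

(** The difference of the two generating functions for a given [k] starts in
    degree [k]; dividing it by [t ^+ k] gives a power series indexed from 0, to
    which [pseries_near0_eq0] applies. *)
Lemma is_stirling1_unique (R : realType) (s s' : nat -> nat -> R) :
  is_stirling1 s -> is_stirling1 s' ->
  forall n k, (k <= n)%N -> s n k = s' n k.
Proof.
move=> hs hs' n k kn.
pose c i : R := (s (i + k)%N k - s' (i + k)%N k) / (i + k)`!%:R.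
suff /(_ (n - k)%N) : forall i, c i = 0.
  rewrite /c subnK// => /eqP; rewrite mulf_eq0 invr_eq0 pnatr_eq0 -leqn0.
  by rewrite leqNgt fact_gt0 orbF subr_eq0 => /eqP.
have dhs := nbhs_dnbhs (hs k); have dhs' := nbhs_dnbhs (hs' k).
apply: pseries_near0_eq0; near=> t.
have t0 : t != 0 by near: t; exact: nbhs_dnbhs_neq.
have st : \sum_(k <= n < N) s n k * (t ^+ n / n`!%:R) @[N --> \oo]
    --> k`!%:R^-1 * ln (1 / (1 - t)) ^+ k.
  by near: t; exact: dhs.
have st' : \sum_(k <= n < N) s' n k * (t ^+ n / n`!%:R) @[N --> \oo]
    --> k`!%:R^-1 * ln (1 / (1 - t)) ^+ k.
  by near: t; exact: dhs'.
pose d N := \sum_(k <= n < N) s n k * (t ^+ n / n`!%:R)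
  - \sum_(k <= n < N) s' n k * (t ^+ n / n`!%:R).
have : d N @[N --> \oo] --> (0 : R).
  by rewrite -[0](subrr (k`!%:R^-1 * ln (1 / (1 - t)) ^+ k)); exact: cvgB st st'.
rewrite -(cvg_shiftn k) => /(cvgMl_tmp (a := t ^- k)); rewrite mulr0.
apply: cvg_trans; apply: near_eq_cvg; near=> N.
rewrite /d /pseries /series /= -sumrB -[X in index_iota X (N + k)]add0n big_addn addnK mulr_sumr.
apply: eq_bigr => i _; rewrite /c exprD.
have : t ^+ k != 0 by rewrite expf_neq0.
have : (i + k)`!%:R != 0 :> R by rewrite pnatr_eq0 -lt0n fact_gt0.
by move=> f0 tk; field; rewrite tk f0.
Unshelve. all: by end_near. Qed.

End power_series_uniqueness.

(** The recurrence, summed over [m], contributes [n * n`!] from the terms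
    [n * stirling1_rec n m.+1] and [n`!] from the shifted terms.  In the former
    the value at [m = 0] is missing, which is harmless: it is 0 for [n > 0], and
    the factor [n] is 0 otherwise. *)
Lemma sum_stirling1_rec n : (\sum_(m < n.+1) stirling1_rec n m)%N = n`!.
Proof.
elim: n => [|n IH]; first by rewrite big_ord1.
rewrite big_ord_recl /= add0n big_split /= -big_distrr /= IH factS mulSn addnC.
congr (_ + _)%N; case: n IH => [|n] IH; first by rewrite !mul0n.
congr (_ * _)%N; rewrite -IH [RHS]big_ord_recl add0n big_ord_recr.
by rewrite -[RHS]addn0; congr addn; exact: stirling1_rec_small.
Qed.

Lemma sum_stirling1 (R : realType) (s : nat -> nat -> R) (n : nat) :
  is_stirling1 s -> \sum_(m < n.+1) s n m = n`!%:R.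
Proof.
move=> hs; rewrite -sum_stirling1_rec natr_sum; apply: eq_bigr => m _.
by apply: (@is_stirling1_unique R _ _ hs (is_stirling1_rec R)); rewrite -ltnS.
Qed.

(** Telescoping of [L_i / i`! = J_i / i`! - J_(i-1) / (i-1)`!]. *)
Lemma sum_L (R : realType) (n : nat) :
  \sum_(i < n.+1) (i`!%:R^-1 *: L R i) = n`!%:R^-1 *: J R n.
Proof.
elim: n => [|n IH]; first by rewrite big_ord1 /L subr0.
rewrite big_ord_recr /= IH /L scalerBr [in X in _ - X]scalerA factS natrM invfM.
by rewrite [in X in _ - X]mulrAC mulVf ?pnatr_eq0// mul1r addrC subrK.
Qed.

Theorem theorem3p8 (R : realType) (s : nat -> nat -> R)
    (hs : is_stirling1 s) (n : nat) :
  J R n = \sum_(j < n.+1)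
            ('C(n, j)%:R *: L R (n - j)) * (\sum_(m < j.+1) s j m)%:P.
Proof.
have fact_neq0 m : m`!%:R != 0 :> R by rewrite pnatr_eq0 -lt0n fact_gt0.
transitivity (\sum_(j < n.+1) n`!%:R *: ((n - j)`!%:R^-1 *: L R (n - j))).
  rewrite -scaler_sumr (reindex_inj rev_ord_inj) /=.
  under eq_bigr => j _ do rewrite subSS subKn -1?ltnS//.
  by rewrite sum_L scalerA divff// scale1r.
apply: eq_bigr => j _; rewrite sum_stirling1// mulrC mul_polyC !scalerA.
congr (_ *: _); rewrite -(@bin_fact n j) -1?ltnS// !natrM.
by rewrite mulrA mulfK// mulrC.
Qed.
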